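(* For every formula $A$, the following formulae are derivable in $\mathbf{GAMALL}$: (1) $\boxdot A\to A$; (2) $A\to\Diamond A$.
   Context: Formulae are built from propositional variables and constants $0,1,\bot,\top$ using the connectives $\otimes$, $\oplus$ (multiplicative disjunction, ''par''), $\land$, $\lor$ (additive conjunction and disjunction), $\neg$, $\to$. A sequent $\Gamma\Rightarrow\Delta$ is a pair of finite multisets of formulae; commas denote multiset union. A formula $C$ is derivable in a calculus if the sequent ${}\Rightarrow C$ is derivable. The calculus $\mathbf{GMALL}$ for Multiplicative Additive Linear Logic has the following rules (no cut, weakening or contraction). Axioms: $A\Rightarrow A$; $0\Rightarrow{}$; ${}\Rightarrow 1$; $\bot,\Gamma\Rightarrow\Delta$; $\Gamma\Rightarrow\Delta,\top$. $(R0)$ from $\Gamma\Rightarrow\Delta$ infer $\Gamma\Rightarrow\Delta,0$. $(L1)$ from $\Gamma\Rightarrow\Delta$ infer $1,\Gamma\Rightarrow\Delta$. $(L\otimes)$ from $\Gamma,A,B\Rightarrow\Delta$ infer $A\otimes B,\Gamma\Rightarrow\Delta$. $(R\otimes)$ from $\Gamma\Rightarrow\Delta,A$ and $\Gamma'\Rightarrow\Delta',B$ infer $\Gamma,\Gamma'\Rightarrow\Delta,\Delta',A\otimes B$. $(L\oplus)$ from $A,\Gamma\Rightarrow\Delta$ and $B,\Gamma'\Rightarrow\Delta'$ infer $A\oplus B,\Gamma,\Gamma'\Rightarrow\Delta,\Delta'$. $(R\oplus)$ from $\Gamma\Rightarrow\Delta,A,B$ infer $\Gamma\Rightarrow\Delta,A\oplus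 B$. $(L\land_1),(L\land_2)$ from $A,\Gamma\Rightarrow\Delta$, respectively from $B,\Gamma\Rightarrow\Delta$, infer $A\land B,\Gamma\Rightarrow\Delta$. $(R\land)$ from $\Gamma\Rightarrow\Delta,A$ and $\Gamma\Rightarrow\Delta,B$ infer $\Gamma\Rightarrow\Delta,A\land B$. $(L\lor)$ from $A,\Gamma\Rightarrow\Delta$ and $B,\Gamma\Rightarrow\Delta$ infer $A\lor B,\Gamma\Rightarrow\Delta$. $(R\lor_1),(R\lor_2)$ from $\Gamma\Rightarrow\Delta,A$, respectively from $\Gamma\Rightarrow\Delta,B$, infer $\Gamma\Rightarrow\Delta,A\lor B$. $(L\neg)$ from $\Gamma\Rightarrow\Delta,A$ infer $\neg A,\Gamma\Rightarrow\Delta$. $(R\neg)$ from $A,\Gamma\Rightarrow\Delta$ infer $\Gamma\Rightarrow\Delta,\neg A$. $(L\to)$ from $\Gamma\Rightarrow\Delta,A$ and $B,\Gamma'\Rightarrow\Delta'$ infer $A\to B,\Gamma,\Gamma'\Rightarrow\Delta,\Delta'$. $(R\to)$ from $A,\Gamma\Rightarrow\Delta,B$ infer $\Gamma\Rightarrow\Delta,A\to B$. $\mathbf{GAMALL}$ (a calculus for Affine Logic) is $\mathbf{GMALL}$ extended with the weakening rules $(LW)$: from $\Gamma\Rightarrow\Delta$ infer $A,\Gamma\Rightarrow\Delta$; $(RW)$: from $\Gamma\Rightarrow\Delta$ infer $\Gamma\Rightarrow\Delta,A$. The Tarskian modalities are the abbreviations $\Diamond A := \neg A\to A$ and $\boxdot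 A := \neg\Diamond\neg A$. *)

(* Defs.v *)
From Stdlib Require Import List Permutation.
Import ListNotations.

(* [Zero] and [One] are the multiplicative constants (units of [Par] and
   [Tensor]); [Bot] and [Top] are the additive ones (units of [Or] and [And]).
   This is the convention in which falsity of "par" is written 0, and differs
   from Girard's notation. *)
Inductive formula : Type :=
| Var (p : nat)
| Zero
| One
| Bot
| Top
| Tensor (A B : formula)
| Par (A B : formula)
| And (A B : formula)
| Or (A B : formula)
| Neg (A : formula)
| Imp (A B : formula).

(* Finite multisets are represented by lists; the identification of lists up to
   permutation is made in [derivable] below.  Hence the position at which the
   principal formula is displayed in a rule is immaterial. *)
Definition sequent : Type := (list formula * list formula)%type.

Declare Scope sequent_scope.
Delimit Scope sequent_scope with seqt.
Notation "G ==> D" := (@pair (list formula) (list formula) G D)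
  (at level 75, no associativity) : sequent_scope.
Local Open Scope sequent_scope.

(* A calculus is given by its rule instances: a list of premises and a
   conclusion. *)
Definition calculus : Type := list sequent -> sequent -> Prop.

Inductive derivable (R : calculus) : sequent -> Prop :=
| der_rule (ps : list sequent) (s : sequent) :
    R ps s -> (forall p, In p ps -> derivable R p) -> derivable R s
| der_perm (G G' D D' : list formula) :
    Permutation G G' -> Permutation D D' ->
    derivable R (G ==> D) -> derivable R (G' ==> D').

Definition derivable_formula (R : calculus) (C : formula) : Prop :=
  derivable R ([] ==> [C]).

Inductive GMALL : calculus :=
| Ax A : GMALL [] ([A] ==> [A])
| L0 : GMALL [] ([Zero] ==> [])
| R1 : GMALL [] ([] ==> [One])
| LBot G D : GMALL [] (Bot :: G ==> D)
| RTop G D : GMALL [] (G ==> Top :: D)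
| R0 G D : GMALL [G ==> D] (G ==> Zero :: D)
| L1 G D : GMALL [G ==> D] (One :: G ==> D)
| LTensor G D A B :
    GMALL [A :: B :: G ==> D] (Tensor A B :: G ==> D)
| RTensor G D G' D' A B :
    GMALL [G ==> A :: D; G' ==> B :: D'] (G ++ G' ==> Tensor A B :: D ++ D')
| LPar G D G' D' A B :
    GMALL [A :: G ==> D; B :: G' ==> D'] (Par A B :: G ++ G' ==> D ++ D')
| RPar G D A B :
    GMALL [G ==> A :: B :: D] (G ==> Par A B :: D)
| LAnd1 G D A B : GMALL [A :: G ==> D] (And A B :: G ==> D)
| LAnd2 G D A B : GMALL [B :: G ==> D] (And A B :: G ==> D)
| RAnd G D A B :
    GMALL [G ==> A :: D; G ==> B :: D] (G ==> And A B :: D)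
| LOr G D A B :
    GMALL [A :: G ==> D; B :: G ==> D] (Or A B :: G ==> D)
| ROr1 G D A B : GMALL [G ==> A :: D] (G ==> Or A B :: D)
| ROr2 G D A B : GMALL [G ==> B :: D] (G ==> Or A B :: D)
| LNeg G D A : GMALL [G ==> A :: D] (Neg A :: G ==> D)
| RNeg G D A : GMALL [A :: G ==> D] (G ==> Neg A :: D)
| LImp G D G' D' A B :
    GMALL [G ==> A :: D; B :: G' ==> D'] (Imp A B :: G ++ G' ==> D ++ D')
| RImp G D A B : GMALL [A :: G ==> B :: D] (G ==> Imp A B :: D).

Inductive GAMALL : calculus :=
| GAMALL_GMALL ps s : GMALL ps s -> GAMALL ps s
| LW G D A : GAMALL [G ==> D] (A :: G ==> D)
| RW G D A : GAMALL [G ==> D] (G ==> A :: D).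

Definition Diamond (A : formula) : formula := Imp (Neg A) A.
Definition Boxdot (A : formula) : formula := Neg (Diamond (Neg A)).

(* Main.v *)
Require Import Defs.
From Stdlib Require Import List.
Import ListNotations.

(** In [Diamond B], that is [Neg B -> B], the antecedent [Neg B] can be
    discarded by weakening, so deriving [B], in any context, suffices to derive
    [Diamond B].  Thus [A -> Diamond A] reduces to [A ==> A].  Dually
    [Boxdot A] is the negation of [Diamond (Neg A)], so [Boxdot A -> A] reduces
    to the excluded middle for [Par], the sequent with empty antecedent and
    succedent [Neg A, A], which is [A ==> A] with [A] moved across by [RNeg]. *)

Local Open Scope sequent_scope.

Lemma derivable_axiom (R : calculus) (s : sequent) : R [] s -> derivable R s.
Proof. intro H; apply (der_rule R [] s H); intros p []. Qed.

Lemma derivable_unary (R : calculus) (p s : sequent) :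
  R [p] s -> derivable R p -> derivable R s.
Proof. intros H Hp; apply (der_rule R [p] s H); intros q [<- | []]; exact Hp. Qed.

Lemma GAMALL_identity (A : formula) : derivable GAMALL ([A] ==> [A]).
Proof. apply derivable_axiom, GAMALL_GMALL, Ax. Qed.

Lemma GAMALL_RNeg (G D : list formula) (A : formula) :
  derivable GAMALL (A :: G ==> D) -> derivable GAMALL (G ==> Neg A :: D).
Proof. apply derivable_unary, GAMALL_GMALL, RNeg. Qed.

Lemma GAMALL_LNeg (G D : list formula) (A : formula) :
  derivable GAMALL (G ==> A :: D) -> derivable GAMALL (Neg A :: G ==> D).
Proof. apply derivable_unary, GAMALL_GMALL, LNeg. Qed.

Lemma GAMALL_RImp (G D : list formula) (A B : formula) :
  derivable GAMALL (A :: G ==> B :: D) -> derivable GAMALL (G ==> Imp A B :: D).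
Proof. apply derivable_unary, GAMALL_GMALL, RImp. Qed.

Lemma GAMALL_LW (G D : list formula) (A : formula) :
  derivable GAMALL (G ==> D) -> derivable GAMALL (A :: G ==> D).
Proof. apply derivable_unary, LW. Qed.

(** The only use of weakening: it supplies the antecedent [Neg B] of
    [Diamond B]. *)
Lemma GAMALL_RDiamond (G D : list formula) (B : formula) :
  derivable GAMALL (G ==> B :: D) -> derivable GAMALL (G ==> Diamond B :: D).
Proof. intro H; apply GAMALL_RImp, GAMALL_LW, H. Qed.

Theorem mainTheorem9 :
  forall A : formula,
    derivable_formula GAMALL (Imp (Boxdot A) A) /\
    derivable_formula GAMALL (Imp A (Diamond A)).
Proof.
  intro A; split.
  - apply GAMALL_RImp, GAMALL_LNeg, GAMALL_RDiamond, GAMALL_RNeg.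
    apply GAMALL_identity.
  - apply GAMALL_RImp, GAMALL_RDiamond, GAMALL_identity.
Qed.
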